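(* The infinite lower-triangular matrices $\mathsf{F}=(f_{n,k})_{n,k\ge 0}$ and $\mathsf{T}=(t_{n,k})_{n,k\ge 0}$, where for integers $n,k\ge 0$ $$f_{n,k}=\begin{cases}\delta_{nk} & \text{if } k=0,\\ \binom{n-1}{k-1}n^{n-k} & \text{if } n\ge k\ge 1,\\ 0 & \text{if } k>n,\end{cases}\qquad t_{n,k}=\begin{cases}\binom{n}{k}n^{n-k} & \text{if } n\ge k,\\ 0&\text{if } k>n,\end{cases}$$ are both totally positive.
   Context: A (finite or infinite) real matrix is totally positive if all of its minors (determinants of finite square submatrices formed from any increasing choice of rows and any increasing choice of the same number of columns) are nonnegative. $\delta_{nk}$ is the Kronecker delta, and $0^0=1$ (so $t_{0,0}=1$). *)

(* Defs.v *)
From mathcomp Require Import all_boot all_order all_algebra.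
From mathcomp Require Import reals.

Set Implicit Arguments.
Unset Strict Implicit.
Unset Printing Implicit Defensive.

Import Order.TTheory GRing.Theory Num.Theory.
Local Open Scope ring_scope.

(* Infinite matrices, with rows and columns indexed from 0. *)
Definition infmx (R : Type) : Type := nat -> nat -> R.

Definition increasing_choice (m : nat) (r : 'I_m -> nat) : Prop :=
  forall i j : 'I_m, (i < j)%N -> (r i < r j)%N.

Definition minor_of (R : realType) (A : infmx R) (m : nat)
    (r c : 'I_m -> nat) : R :=
  \det (\matrix_(i < m, j < m) A (r i) (c j)).

Definition totally_positive (R : realType) (A : infmx R) : Prop :=
  forall (m : nat) (r c : 'I_m -> nat),
    increasing_choice r -> increasing_choice c -> 0 <= minor_of A r c.

(* The truncated subtractions below are only reached in ranges where they are
   genuine ones; 0 ^+ 0 = 1 holds definitionally. *)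
Definition forest_mx (R : realType) : infmx R := fun n k =>
  if k == 0%N then (n == k)%:R
  else if (k <= n)%N then 'C(n - 1, k - 1)%:R * n%:R ^+ (n - k)
  else 0.

Definition tree_mx (R : realType) : infmx R := fun n k =>
  if (k <= n)%N then 'C(n, k)%:R * n%:R ^+ (n - k) else 0.

(* Main.v *)
Require Import Defs.
From mathcomp Require Import all_boot all_order all_algebra.
From mathcomp Require Import reals.

(** The two matrices generate each other.  Put [S j k = j! / k!] for [k <= j]
    and [B j k = 'C(j, k)], both lower triangular.  Then

      [T = F * S]   and   [F = 1 (+) (T * B)],

    where [1 (+) M] borders [M] by a new zeroth row and column whose only
    nonzero entry is a 1 in the corner.  The first identity is the entrywise
    relation [T n k = F n k + (k + 1) * T n (k + 1)], that is, [T] times a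
    bidiagonal matrix is [F] (lemma [tree_mx_forest_mx]).  The second says that
    [(x + n) ^ n] becomes [(x + (n + 1)) ^ n] under [x := x + 1] (lemma
    [forest_mxSS]).

    Both [S] and [B] are products of matrices that add to a column a nonnegative
    multiple of the next column, and this operation preserves total positivity:
    expanding a minor along the modified column gives the old minor plus a
    nonnegative multiple of another minor, or of a determinant with two equal
    columns ([totally_positive_add_next_col]).  Bordering also preserves total
    positivity.  Since bordering shifts the rows down by one, the first [N + 1]
    rows of [F] come from the first [N] rows of [T], which in turn come from the
    first [N] rows of [F]; induction on [N] proves that all row truncations are
    totally positive, and every minor is a minor of such a truncation.

    The factorization of [S] and [B] into elementary column operations replaces
    the Cauchy-Binet formula. *)

Import Order.TTheory GRing.Theory Num.Theory.
Local Open Scope ring_scope.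

(** * Minors *)

Lemma increasing_choice_inj {m} {r : 'I_m -> nat} :
  increasing_choice r -> injective r.
Proof.
move=> rI i j eq_ij; apply: ord_inj.
by case: (ltngtP i j) => // /rI; rewrite eq_ij ltnn.
Qed.

(** A minor involves finitely many rows and columns, so total positivity may be
    checked on approximations, which may vary with the window.  This is what
    turns infinite sequences of column operations into finite ones. *)
Lemma totally_positive_local (R : realType) (A : infmx R) :
  (forall N, exists2 B : infmx R, totally_positive B &
     forall n k, (n < N)%N -> (k < N)%N -> A n k = B n k) ->
  totally_positive A.
Proof.
move=> AB m r c rI cI.
pose N := (\max_i r i + \max_i c i).+1.
have [B Btp eqAB] := AB N.
suff -> : minor_of A r c = minor_of B r c by apply: Btp.
congr (\det _); apply/matrixP=> i j; rewrite !mxE eqAB // ltnS.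
  exact: leq_trans (leq_bigmax i) (leq_addr _ _).
exact: leq_trans (leq_bigmax j) (leq_addl _ _).
Qed.

Lemma totally_positive_ext (R : realType) (A B : infmx R) :
  (forall n k, A n k = B n k) -> totally_positive B -> totally_positive A.
Proof.
by move=> eqAB Btp; apply: totally_positive_local => N; exists B => // n k _ _.
Qed.

Lemma minor_of_zero_row {R : realType} {A : infmx R} {m} {r c : 'I_m -> nat} i0 :
  (forall j, A (r i0) (c j) = 0) -> minor_of A r c = 0.
Proof.
move=> A0; rewrite /minor_of (expand_det_row _ i0) big1 // => j _.
by rewrite mxE A0 mul0r.
Qed.

Lemma minor_of_zero_col {R : realType} {A : infmx R} {m} {r c : 'I_m -> nat} j0 :
  (forall i, A (r i) (c j0) = 0) -> minor_of A r c = 0.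
Proof.
move=> A0; rewrite /minor_of (expand_det_col _ j0) big1 // => i _.
by rewrite mxE A0 mul0r.
Qed.

Lemma totally_positive0 (R : realType) :
  totally_positive (fun _ _ => 0 : R).
Proof.
case=> [|m] r c _ _; first by rewrite /minor_of det_mx00.
by rewrite (minor_of_zero_row ord0).
Qed.

(** * Column operations *)

(** Why consecutive columns: in the extra determinant column [j] is replaced by
    column [j.+1], which either is already chosen, and then the determinant
    vanishes, or takes the place of [j] without disturbing the order of the
    chosen columns. *)
Lemma totally_positive_add_next_col {R : realType} {A A' : infmx R} j {s} :
    0 <= s ->
    (forall n k, A' n k = A n k + (if k == j then s * A n k.+1 else 0)) ->
  totally_positive A -> totally_positive A'.
Proof.
move=> s0 A'E Atp m r c rI cI.
have c_inj := increasing_choice_inj cI.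
have [/existsP[i0 /eqP ci0]|/existsPn nj] := boolP [exists i, c i == j]; last first.
  suff -> : minor_of A' r c = minor_of A r c by apply: Atp.
  congr (\det _); apply/matrixP=> p q.
  by rewrite !mxE A'E (negPf (nj q)) addr0.
pose c' i := if i == i0 then j.+1 else c i.
(* Determinants are multilinear in rows, hence the transpositions. *)
have -> : minor_of A' r c = minor_of A r c + s * minor_of A r c'.
  rewrite /minor_of -[\det _]det_tr.
  rewrite -[X in _ = X + _]det_tr -[X in _ = _ + _ * X]det_tr.
  rewrite -[X in _ = X + _]mul1r; apply: (determinant_multilinear (i0 := i0)).
  - by apply/rowP=> p; rewrite !mxE /c' A'E ci0 !eqxx mul1r.
  - apply/matrixP=> p q; rewrite !mxE A'E -ci0 (inj_eq c_inj).
    by rewrite eq_sym (negPf (neq_lift _ _)) addr0.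
  - apply/matrixP=> p q; rewrite !mxE /c' A'E -ci0 (inj_eq c_inj).
    by rewrite eq_sym (negPf (neq_lift _ _)) addr0.
apply: addr_ge0; first exact: Atp.
apply: mulr_ge0 => //.
have [/existsP[i1 /eqP ci1]|/existsPn nj] := boolP [exists i, c i == j.+1].
  have ni : i0 != i1 by apply/eqP=> e; move: ci1; rewrite -e ci0 => /n_Sn.
  rewrite /minor_of -det_tr (determinant_alternate ni) // => p.
  by rewrite !mxE /c' eqxx eq_sym (negPf ni) ci1.
apply: Atp => // p q pq; rewrite /c'.
case: (eqVneq p i0) => [ep|np]; case: (eqVneq q i0) => [eq|nq].
- by move: pq; rewrite ep eq ltnn.
- by rewrite ltn_neqAle eq_sym nj -ci0 cI // -ep.
- by rewrite ltnS ltnW // -ci0 cI // -eq.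
- exact: cI.
Qed.

(** Column [k] must receive the original column [k.+1], so the columns are
    modified from left to right. *)
Lemma totally_positive_bidiagonal (R : realType) (A A' : infmx R) (s : nat -> R) :
    (forall k, 0 <= s k) ->
    (forall n k, A' n k = A n k + s k * A n k.+1) ->
  totally_positive A -> totally_positive A'.
Proof.
move=> s0 A'E Atp; apply: totally_positive_local => N.
exists (fun n k => A n k + (if (k < N)%N then s k * A n k.+1 else 0)); last first.
  by move=> n k _ kN; rewrite kN A'E.
elim: N => [|j IHj].
  by apply: totally_positive_ext Atp => n k; rewrite addr0.
apply: (totally_positive_add_next_col j (s0 j) _ IHj) => n k /=.
rewrite ltnS leq_eqVlt; have [->|nkj] := eqVneq k j.
  by rewrite !ltnn ltnNge leqnSn /= !addr0.
by rewrite /= addr0.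
Qed.

(** Division by a bidiagonal matrix with nonpositive off-diagonal entries.  Here
    column [k] receives the already modified column [k.+1], so the columns are
    treated from right to left; the vanishing of the columns from [N] on
    provides the starting point. *)
Lemma totally_positive_inv_bidiagonal {R : realType} {A A' : infmx R}
    {s : nat -> R} {N} :
    (forall k, 0 <= s k) ->
    (forall n k, A' n k = A n k + s k * A' n k.+1) ->
    (forall n k, (N <= k)%N -> A' n k = 0) ->
  totally_positive A -> totally_positive A'.
Proof.
move=> s0 A'E A'0 Atp.
pose X j n k := if (j <= k)%N then A' n k else A n k.
suff /(_ N) : forall i, totally_positive (X (N - i)%N) by rewrite subnn.
elim=> [|i IHi].
  apply: totally_positive_ext Atp => n k; rewrite /X subn0; case: leqP => // Nk.
  by rewrite A'E A'0 ?mulr0 ?addr0 // leqW.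
have [iN|Ni] := ltnP i N; last first.
  by move: IHi; rewrite (eqP Ni) (eqP (leqW Ni)).
move: IHi; rewrite -(subnSK iN); set j := (N - i.+1)%N.
apply: (totally_positive_add_next_col j (s0 j)) => n k; rewrite /X.
have [->|nkj] := eqVneq k j; first by rewrite leqnn !ltnn !leqnn -A'E.
by rewrite addr0 leq_eqVlt eq_sym (negPf nkj).
Qed.

(** Pascal's rule factors the binomial matrix as [B = (1 (+) B) * E], where [E]
    is bidiagonal with all its nonzero entries equal to 1.  Iterating, only the
    trivial factor acts on the first [N] columns after [N] steps. *)
Lemma totally_positive_binomial {R : realType} {A : infmx R} {N} :
    (forall n k, (N <= k)%N -> A n k = 0) ->
  totally_positive A ->
  totally_positive (fun n k => \sum_(j < N) A n j * 'C(j, k)%:R).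
Proof.
move=> A0 Atp.
(* [X m] is [A] times the binomial matrix bordered [m] times. *)
pose X m n k := if (k < m)%N then A n k
  else \sum_(m <= j < N) A n j * 'C(j - m, k - m)%:R.
have XS m n k : (m < N)%N -> X m n k = X m.+1 n k + (m <= k)%:R * X m.+1 n k.+1.
  move=> mN; rewrite /X ltnS.
  case: (ltngtP k m) => [km|mk|->].
  - by rewrite mul0r addr0.
  - rewrite mul1r ltnS ltnNge (ltnW mk) /= big_ltn // subnn.
    rewrite bin_small ?subn_gt0 // mulr0 add0r -big_split /= !big_nat.
    apply: eq_bigr => j /andP[mj _].
    by rewrite -mulrDr -natrD subSS -(subnSK mj) -(subnSK mk) binS addnC.
  - rewrite mul1r ltnn big_ltn // !subnn bin0 mulr1.
    congr (_ + _); apply: eq_bigr => j _; rewrite !bin0 //.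
suff /(_ N) : forall i, totally_positive (X (N - i)%N).
  rewrite subnn; apply: totally_positive_ext => n k.
  by rewrite /X ltn0 big_mkord; apply: eq_bigr => j _; rewrite !subn0.
elim=> [|i IHi].
  apply: totally_positive_ext Atp => n k; rewrite /X subn0; case: ltnP => // Nk.
  by rewrite big_geq // A0.
have [iN|Ni] := ltnP i N; last first.
  by move: IHi; rewrite (eqP Ni) (eqP (leqW Ni)).
move: IHi; rewrite -(subnSK iN).
have jN : (N - i.+1 < N)%N by rewrite ltn_subrL (leq_ltn_trans _ iN).
by apply: totally_positive_bidiagonal (fun n k => XS _ n k jN) => k; apply: ler0n.
Qed.

(** * Bordering *)

(** A minor that uses exactly one of the two new lines has a zero line; one that
    uses both reduces to its complementary minor at the corner. *)
Lemma totally_positive_border (R : realType) (A A' : infmx R) :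
    A' 0%N 0%N = 1 -> (forall k, A' 0%N k.+1 = 0) -> (forall n, A' n.+1 0%N = 0) ->
    (forall n k, A' n.+1 k.+1 = A n k) ->
  totally_positive A -> totally_positive A'.
Proof.
move=> A00 A0r A0c A'S Atp [|m] r c rI cI; first by rewrite /minor_of det_mx00.
have pred_inc p (f : 'I_p -> nat) : (forall i, (0 < f i)%N) ->
    increasing_choice f -> increasing_choice (fun i => (f i).-1).
  by move=> f0 fI i j ij; rewrite -ltnS !prednK // fI.
have lift_inc (f : 'I_m.+1 -> nat) :
    increasing_choice f -> increasing_choice (fun i => f (lift ord0 i)).
  by move=> fI i j ij; apply: fI.
have lift_gt0 (f : 'I_m.+1 -> nat) i : increasing_choice f -> (0 < f (lift ord0 i))%N.
  by move=> fI; apply: leq_ltn_trans (leq0n _) (fI ord0 _ _).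
have all_gt0 (f : 'I_m.+1 -> nat) i : increasing_choice f -> (0 < f ord0)%N -> (0 < f i)%N.
  by move=> fI f0; case: (unliftP ord0 i) => [j|] -> //; apply: lift_gt0.
have A'E n k : (0 < n)%N -> (0 < k)%N -> A' n k = A n.-1 k.-1.
  by case: n => // n _; case: k => // k _; rewrite A'S.
case: (posnP (r ord0)) => [r0|r0]; case: (posnP (c ord0)) => [c0|c0].
- rewrite /minor_of (expand_det_row _ ord0) big_ord_recl mxE r0 c0 A00 mul1r.
  rewrite big1 ?addr0 => [|i _]; last first.
    by rewrite mxE r0 -(prednK (lift_gt0 c i cI)) A0r mul0r.
  rewrite /cofactor /= expr0 mul1r.
  have := Atp m _ _ (pred_inc _ _ (fun i => lift_gt0 r i rI) (lift_inc r rI))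
                    (pred_inc _ _ (fun i => lift_gt0 c i cI) (lift_inc c cI)).
  rewrite /minor_of; congr (0 <= \det _); apply/matrixP=> i j.
  by rewrite !mxE A'E ?lift_gt0.
- rewrite (minor_of_zero_row ord0) // => j.
  by rewrite r0 -(prednK (all_gt0 c j cI c0)) A0r.
- rewrite (minor_of_zero_col ord0) // => i.
  by rewrite c0 -(prednK (all_gt0 r i rI r0)) A0c.
- have := Atp _ _ _ (pred_inc _ _ (fun i => all_gt0 r i rI r0) rI)
                    (pred_inc _ _ (fun i => all_gt0 c i cI c0) cI).
  rewrite /minor_of; congr (0 <= \det _); apply/matrixP=> i j.
  by rewrite !mxE A'E //; apply: all_gt0.
Qed.

(** * The forest and tree matrices *)

Lemma tree_mx_forest_mx (R : realType) n k :
  tree_mx R n k = forest_mx R n k + k.+1%:R * tree_mx R n k.+1.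
Proof.
rewrite /tree_mx /forest_mx; case: k => [|k].
  case: n => [|n]; first by rewrite /= mulr0 addr0 mul1r.
  by rewrite /= add0r !mul1r subn0 subSS subn0 bin1 exprS.
case: n => [|n]; first by rewrite /= mulr0 addr0.
rewrite /= !ltnS !subSS !subn0; case: (ltngtP k n) => [kn|nk|->].
- rewrite -(subnSK kn) exprS !mulrA -mulrDl; congr (_ * _).
  rewrite -!natrM -natrD; congr (_%:R).
  rewrite mul_bin_left [('C(n, k) * _)%N]mulnC (mul_bin_diag n.+1) -mulnDl.
  by rewrite subSS addSn subnKC ?(ltnW kn) // mulnC.
- by rewrite mulr0 addr0.
- by rewrite mulr0 addr0 subnn !binn.
Qed.

Lemma coef_XaddC_exp (R : comNzRingType) (c : R) n k :
  (('X + c%:P) ^+ n)`_k = 'C(n, k)%:R * c ^+ (n - k).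
Proof.
rewrite addrC exprDn coef_sum.
under eq_bigr => i _ do
  rewrite coefMn -polyC_exp coefCM -mulr_natl coefXn.
have [kn|nk] := ltnP k n.+1.
  rewrite (bigD1 (Ordinal kn)) //= eqxx mulr1 big1 ?addr0 // => i ik.
  by case: eqP => [e|_]; rewrite ?mulr0 //; move: ik; rewrite -val_eqE /= e eqxx.
rewrite bin_small // mul0r big1 // => i _.
by case: eqP => [e|_]; rewrite ?mulr0 //; move: (ltn_ord i); rewrite -e ltnNge nk.
Qed.

(** Compare the coefficients of ['X^k] in [('X + (x + 1)) ^+ n], expanded
    directly and as [(('X + 1) + x) ^+ n]. *)
Lemma sum_binomial_shift (R : comNzRingType) (x : R) n k :
  \sum_(j < n.+1) 'C(n, j)%:R * x ^+ (n - j) * 'C(j, k)%:R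
    = 'C(n, k)%:R * (x + 1) ^+ (n - k).
Proof.
rewrite -coef_XaddC_exp polyCD addrCA exprDn coef_sum; apply: eq_bigr => j _.
by rewrite coefMn -polyC_exp coefCM coef_XaddC_exp expr1n mulr1 -mulrA mulr_natl.
Qed.

Lemma forest_mxSS (R : realType) n k N : (n < N)%N ->
  forest_mx R n.+1 k.+1 = \sum_(j < N) tree_mx R n j * 'C(j, k)%:R.
Proof.
move=> nN; transitivity ('C(n, k)%:R * (n%:R + 1) ^+ (n - k) : R).
  rewrite /forest_mx /= ltnS !subSS !subn0 -natr1; case: leqP => // nk.
  by rewrite bin_small // mul0r.
pose t j : R := 'C(n, j)%:R * n%:R ^+ (n - j) * 'C(j, k)%:R.
rewrite -sum_binomial_shift (big_ord_widen N t) //.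
rewrite big_mkcond; apply: eq_bigr => j _; rewrite /tree_mx ltnS.
by case: leqP => // _; rewrite mul0r.
Qed.

(** * Induction on the number of rows *)

(** Discarded rows are set to zero rather than removed, so that the column
    operations apply unchanged while lower triangularity leaves only finitely
    many nonzero columns. *)
Definition truncate_rows {R : realType} (N : nat) (A : infmx R) : infmx R :=
  fun n k => if (n < N)%N then A n k else 0.

(** One step of the induction goes from [F] to [T] by dividing by a bidiagonal
    matrix, then from [T] to [F] with one more row by the binomial matrix and
    bordering. *)
Lemma totally_positive_truncations (R : realType) N :
  totally_positive (truncate_rows N (forest_mx R)) /\
  totally_positive (truncate_rows N (tree_mx R)).
Proof.
have tree0 M n k : (M <= k)%N -> truncate_rows M (tree_mx R) n k = 0.
  rewrite /truncate_rows /tree_mx => Mk; case: ltnP => // nM.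
  by rewrite leqNgt (leq_trans nM Mk).
have FT M : totally_positive (truncate_rows M (forest_mx R)) ->
    totally_positive (truncate_rows M (tree_mx R)).
  apply: (totally_positive_inv_bidiagonal (s := fun k => k.+1%:R) _ _ (tree0 M)) => //.
  move=> n k; rewrite /truncate_rows; case: ltnP => _; last by rewrite mulr0 addr0.
  exact: tree_mx_forest_mx.
suff Ftp : totally_positive (truncate_rows N (forest_mx R)) by split=> //; apply: FT.
elim: N => [|N /FT/(totally_positive_binomial (tree0 N))].
  exact: totally_positive_ext (totally_positive0 R).
apply: totally_positive_border => [|k|n|n k] //.
  by rewrite /truncate_rows; case: ifP.
rewrite /truncate_rows ltnS; case: ltnP => nN; first exact: forest_mxSS.
by rewrite big1 // => j _; rewrite mul0r.
Qed.

Theorem theorem1p1 (R : realType) :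
  totally_positive (forest_mx R) /\ totally_positive (tree_mx R).
Proof.
split; apply: totally_positive_local => N.
  by exists (truncate_rows N (forest_mx R)) => [|n k nN _];
    [have [] := totally_positive_truncations R N | rewrite /truncate_rows nN].
by exists (truncate_rows N (tree_mx R)) => [|n k nN _];
  [have [] := totally_positive_truncations R N | rewrite /truncate_rows nN].
Qed.
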